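(* Let $q>9$ be an odd prime power and let $\widetilde G=\mathrm{PGL}_2(q)$ act on the projective line $\mathrm{GF}(q)\cup\{\infty\}$. Let $\mathcal{Q}$ be the set of nonzero squares in $\mathrm{GF}(q)$, $V_0=\mathcal{Q}\cup\{0\}$ and $U_0=\mathcal{Q}\cup\{\infty\}$. Then: (1) If $q\equiv 1\pmod 4$, the setwise stabiliser of $\mathcal{Q}$ in $\mathrm{PGL}_2(q)$ is $\{x\mapsto ax: a\in\mathcal{Q}\}\cup\{x\mapsto b/x: b\in\mathcal{Q}\}$. (2) The setwise stabilisers of $V_0$ and of $U_0$ in $\mathrm{PGL}_2(q)$ are both equal to $\{x\mapsto ax: a\in\mathcal{Q}\}$.
   Context: $\mathrm{PGL}_2(q)$ is the group of permutations $x\mapsto \frac{ax+b}{cx+d}$ of $\mathrm{GF}(q)\cup\{\infty\}$ with $a,b,c,d\in\mathrm{GF}(q)$, $ad-bc\ne 0$, under composition, with the conventions $a/0=\infty$ for $a\ne 0$ and $\frac{\infty a+b}{\infty c+d}=\frac{a}{c}$. *)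

(* Defs.v *)
From mathcomp Require Import all_boot all_algebra all_fingroup.
From mathcomp Require Import ring.

Set Implicit Arguments.
Unset Strict Implicit.
Unset Printing Implicit Defensive.

Import GRing.Theory.
Local Open Scope ring_scope.

(* The projective line GF(q) U {oo} is [option F], with [None] as oo. *)

(* When a * d - b * c != 0, a vanishing denominator forces a nonzero
   numerator, so the two [None] branches are exactly the convention
   a / 0 = oo for a != 0. *)
Definition mobius (F : finFieldType) (a b c d : F) (z : option F) : option F :=
  match z with
  | Some x => if c * x + d == 0 then None else Some ((a * x + b) / (c * x + d))
  | None => if c == 0 then None else Some (a / c)
  end.

Definition is_mobius (F : finFieldType) (a b c d : F)
    (s : {perm (option F)}) : bool :=
  [forall z, s z == mobius a b c d z].

Definition PGL2 (F : finFieldType) : {set {perm (option F)}} :=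
  [set s | [exists a, exists b, exists c, exists d,
              (a * d - b * c != 0) && is_mobius a b c d s]].

Definition nzsquares (F : finFieldType) : {set F} :=
  [set x | (x != 0) && [exists y, x == y ^+ 2]].

Definition projQ (F : finFieldType) : {set option F} :=
  [set Some x | x in nzsquares F].

Definition projV0 (F : finFieldType) : {set option F} := projQ F :|: [set Some 0].

Definition projU0 (F : finFieldType) : {set option F} := projQ F :|: [set None].

Definition square_scalings (F : finFieldType) : {set {perm (option F)}} :=
  [set s | [exists a in nzsquares F, is_mobius a 0 0 1 s]].

Definition square_inversions (F : finFieldType) : {set {perm (option F)}} :=
  [set s | [exists b in nzsquares F, is_mobius 0 b 1 0 s]].

Lemma mobius_comp (F : finFieldType) (a b c d a' b' c' d' : F) :
    a * d - b * c != 0 ->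
  forall z, mobius a' b' c' d' (mobius a b c d z) =
    mobius (a' * a + b' * c) (a' * b + b' * d)
           (c' * a + d' * c) (c' * b + d' * d) z.
Proof.
have eN (u v w t : F) : u = v -> w = t ->
    (if u == 0 then None else Some (w / u)) =
    (if v == 0 then None else Some (t / v)) by move=> -> ->.
have sc (k u v w t : F) : k != 0 -> v = k * u -> t = k * w ->
    (if u == 0 then None else Some (w / u)) =
    (if v == 0 then None else Some (t / v)).
  move=> k0 -> ->; rewrite mulf_eq0 (negPf k0) /=.
  by case: ifP => // _; rewrite -mulf_div divff // mul1r.
move=> dN0 [x|] /=.
  case: (altP (c * x + d =P 0)) => [e|n0] /=.
    apply: (sc (a * x + b)).
    - apply: contra dN0 => /eqP n0; have [c0|c0] := eqVneq c 0.
        by move: e; rewrite c0 mul0r add0r => ->; rewrite !mulr0 subr0.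
      have -> : a * d - b * c = a * (c * x + d) - (a * x + b) * c by ring.
      by rewrite e n0 mulr0 mul0r subr0.
    - have -> : (c' * a + d' * c) * x + (c' * b + d' * d)
        = (a * x + b) * c' + d' * (c * x + d) by ring.
      by rewrite e mulr0 addr0.
    - have -> : (a' * a + b' * c) * x + (a' * b + b' * d)
        = (a * x + b) * a' + b' * (c * x + d) by ring.
      by rewrite e mulr0 addr0.
  by apply: (sc (c * x + d)) => //; field.
case: (altP (c =P 0)) => [e|n0] /=.
  apply: (sc a); rewrite ?e; try ring.
  by apply: contra dN0 => /eqP ->; rewrite e mul0r mulr0 subr0.
by apply: (sc c) => //; field.
Qed.

Lemma mobius_scalar (F : finFieldType) (k : F) :
  k != 0 -> mobius k 0 0 k =1 id.
Proof.
by move=> k0 [x|] /=; rewrite ?eqxx // mul0r add0r (negPf k0) addr0 mulrC mulKf.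
Qed.

Lemma mobius_inj (F : finFieldType) (a b c d : F) :
  a * d - b * c != 0 -> injective (mobius a b c d).
Proof.
move=> dN0; apply: (@can_inj _ _ _ (mobius d (- b) (- c) a)) => z.
rewrite mobius_comp //.
have -> : d * a + - b * c = a * d - b * c by ring.
have -> : d * b + - b * d = 0 by ring.
have -> : - c * a + a * c = 0 by ring.
have -> : - c * b + a * d = a * d - b * c by ring.
exact: mobius_scalar.
Qed.

Lemma PGL2P (F : finFieldType) (s : {perm (option F)}) :
  reflect (exists a b c d, a * d - b * c != 0 /\ s =1 mobius a b c d)
          (s \in PGL2 F).
Proof.
rewrite inE; apply: (iffP existsP).
  move=> [a /existsP[b /existsP[c /existsP[d /andP[h /forallP hs]]]]].
  by exists a, b, c, d; split=> // z; apply/eqP.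
move=> [a [b [c [d [h hs]]]]].
exists a; apply/existsP; exists b; apply/existsP; exists c.
apply/existsP; exists d; rewrite h; apply/forallP => z; exact/eqP.
Qed.

Lemma perm_mobius_PGL2 (F : finFieldType) (a b c d : F)
  (h : a * d - b * c != 0) : perm (mobius_inj h) \in PGL2 F.
Proof. by apply/PGL2P; exists a, b, c, d; split=> // z; rewrite permE. Qed.

Lemma PGL2_group_set (F : finFieldType) : group_set (PGL2 F).
Proof.
apply/group_setP; split.
  apply/PGL2P; exists 1, 0, 0, 1; rewrite mulr1 mulr0 subr0 oner_neq0.
  by split=> // z; rewrite perm1 mobius_scalar ?oner_neq0.
move=> s t /PGL2P[a [b [c [d [h hs]]]]] /PGL2P[a' [b' [c' [d' [h' ht]]]]].
apply/PGL2P; exists (a' * a + b' * c), (a' * b + b' * d),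
  (c' * a + d' * c), (c' * b + d' * d); split.
  suff -> : (a' * a + b' * c) * (c' * b + d' * d)
     - (a' * b + b' * d) * (c' * a + d' * c)
     = (a' * d' - b' * c') * (a * d - b * c) by rewrite mulf_neq0.
  by ring.
by move=> z; rewrite permM hs ht mobius_comp.
Qed.

Canonical PGL2_group (F : finFieldType) : {group {perm (option F)}} :=
  Group (PGL2_group_set F).

(* Main.v *)
(* Let m = (q - 1) / 2, so that x ^ m = 1 on the nonzero squares Q, |Q| = m.
   If x |-> (a x + b) / (c x + d) maps Q into Q, then the polynomial
   (a X + b)^m - (c X + d)^m vanishes on Q, hence is a multiple of X^m - 1, and
   its middle coefficients 'C(m, i) (a^i b^(m-i) - c^i d^(m-i)) vanish. Two
   consecutive such relations with nonzero binomials force b = c = 0 or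
   a = d = 0. If the map sends Q U {0} into itself, then likewise
   (a X + b) ((a X + b)^m - (c X + d)^m) is a multiple of X^(m+1) - X; its
   coefficients of degree 2, 3, 4 force b = 0, so that 0 is fixed and Q is
   preserved. The set Q U {oo} is the image of Q U {0} under x |-> 1 / x. *)
Require Import Defs.
From mathcomp Require Import all_boot all_algebra all_fingroup.
From mathcomp Require Import finfield zify ring.

Set Implicit Arguments.
Unset Strict Implicit.
Unset Printing Implicit Defensive.

Import GRing.Theory.

(** * Binomial coefficients modulo 3 *)

(** Here [m] is 13 modulo 27, so only the factor [m - 1] of [m (m - 1) (m - 2)] is divisible by 3,
    and exactly once. Hence 9 does not divide [6 'C(m, 3)]. As [m - 3] is prime to 3, the relation
    [4 'C(m, 4) = (m - 3) 'C(m, 3)] settles the other coefficient. *)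
Lemma bin_3_4_not_dvdn3 (m : nat) :
  27 %| m.*2.+1 -> ~~ (3 %| 'C(m, 3)) /\ ~~ (3 %| 'C(m, 4)).
Proof.
move=> /dvdnP[t mt]; have [w mw] : exists w, m = 27 * w + 13 by exists t./2; lia.
have b1 := mul_bin_left m 0; have b2 := mul_bin_left m 1.
have b3 := mul_bin_left m 2; have b4 := mul_bin_left m 3.
have e3 : 6 * 'C(m, 3) = m * (m - 1) * (m - 2).
  rewrite bin0 in b1; nia.
have C3 : ~~ (3 %| 'C(m, 3)).
  apply/negP => /dvdnP[u eu]; rewrite eu mw in e3.
  have m1 : 27 * w + 13 - 1 = 27 * w + 12 by lia.
  have m2 : 27 * w + 13 - 2 = 27 * w + 11 by lia.
  rewrite m1 m2 in e3.
  lia.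
split=> //; apply/negP => d4.
have : 3 %| (m - 3) * 'C(m, 3) by rewrite -b4 dvdn_mull.
rewrite Euclid_dvdM // (negPf C3) orbF mw; lia.
Qed.

(** * Polynomials determined by their roots *)

Section Interpolation.
Local Open Scope ring_scope.

(** Subtracting the multiple of [r] that cancels the top coefficient leaves a polynomial of size at
    most that of [s], with every element of [s] as a root: it is zero. Coefficients missing from [r]
    are then missing from [p]. *)
Lemma poly_eq_scale_monic (R : idomainType) (p r : {poly R}) (s : seq R) :
    r \is monic -> (size p <= size r <= (size s).+1)%N -> uniq s ->
    all (root p) s -> all (root r) s ->
  p = p`_(size r).-1 *: r.
Proof.
move=> r1 /andP[szpr szrs] us /allP ps /allP rs; apply/eqP; rewrite -subr_eq0; apply/eqP.
apply: (@roots_geq_poly_eq0 _ _ s) => //.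
  apply/allP => x xs.
  rewrite rootE hornerD hornerN hornerZ.
  by rewrite (rootP (ps x xs)) (rootP (rs x xs)) mulr0 subr0.
have szr : size r = (size r).-1.+1 by rewrite prednK // size_poly_gt0 monic_neq0.
apply: (@leq_trans (size r).-1); last by rewrite -ltnS -szr.
apply/leq_sizeP => j; rewrite leq_eqVlt coefB coefZ => /predU1P[<-|lt].
  by rewrite -lead_coefE (monicP r1) mulr1 subrr.
rewrite -szr in lt.
by rewrite (nth_default 0 (leq_trans szpr lt)) [r`_j]nth_default // mulr0 subr0.
Qed.

Lemma exp_linear_poly (R : comNzRingType) (a b : R) (n : nat) :
  (a *: 'X + b%:P) ^+ n = \poly_(i < n.+1) ((a ^+ i * b ^+ (n - i)) *+ 'C(n, i)).
Proof.
rewrite addrC exprDn poly_def; apply: eq_bigr => i _.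
by rewrite exprZn -polyC_exp mul_polyC scalerA scalerMnl mulrC.
Qed.

Lemma coef_linearM (R : comNzRingType) (a b : R) (p : {poly R}) (i : nat) :
  ((a *: 'X + b%:P) * p)`_i.+1 = a * p`_i + b * p`_i.+1.
Proof. by rewrite mulrDl coefD -scalerAl coefZ coefXM coefCM. Qed.

End Interpolation.

(** * Nonzero squares in a field of 2m + 1 elements *)

Section Squares.
Local Open Scope ring_scope.
Variables (F : finFieldType) (m : nat).
Hypothesis cardF : #|F| = m.*2.+1.

Local Notation Q := (nzsquares F).

Lemma nzsquaresP (x : F) : reflect (exists2 y, y != 0 & x = y ^+ 2) (x \in Q).
Proof.
rewrite inE; apply: (iffP andP) => [[x0 /existsP[y /eqP xy]]|[y y0 ->]].
  by exists y => //; apply: contra x0 => /eqP y0; rewrite xy y0 expr0n.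
by split; [rewrite expf_neq0|apply/existsP; exists y].
Qed.

Lemma nzsquares_neq0 (x : F) : x \in Q -> x != 0.
Proof. by rewrite inE => /andP[]. Qed.

Lemma nzsquares0 : (0 \in Q) = false.
Proof. by rewrite inE eqxx. Qed.

Lemma nzsquares1 : 1 \in Q.
Proof. by apply/nzsquaresP; exists 1; rewrite ?oner_neq0 ?expr1n. Qed.

Lemma nzsquaresM (x y : F) : x \in Q -> y \in Q -> x * y \in Q.
Proof.
move=> /nzsquaresP[u u0 ->] /nzsquaresP[v v0 ->]; apply/nzsquaresP.
by exists (u * v); rewrite ?mulf_neq0 // exprMn.
Qed.

Lemma nzsquaresV (x : F) : (x^-1 \in Q) = (x \in Q).
Proof.
have V y : y \in Q -> y^-1 \in Q.
  move=> /nzsquaresP[u u0 ->]; apply/nzsquaresP.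
  by exists u^-1; rewrite ?invr_neq0 // exprVn.
by apply/idP/idP => /V //; rewrite invrK.
Qed.

Lemma nzsquaresMl (a x : F) : a \in Q -> (a * x \in Q) = (x \in Q).
Proof.
move=> aQ; apply/idP/idP => [|xQ]; last exact: nzsquaresM.
move=> /(@nzsquaresM a^-1); rewrite nzsquaresV => /(_ aQ).
by rewrite mulKf // nzsquares_neq0.
Qed.

Lemma nzsquares_exp (x : F) : x \in Q -> x ^+ m = 1.
Proof.
move=> /nzsquaresP[y y0 ->]; rewrite -exprM mul2n.
by apply: (mulfI y0); rewrite mulr1 -exprS -cardF expf_card.
Qed.

(** Each fibre of squaring on the 2m nonzero elements lies in some [{y, -y}]. This bound supplies
    the roots for the interpolation. *)
Lemma card_nzsquares : (m <= #|Q|)%N.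
Proof.
have -> : Q = [set y ^+ 2 | y in [set~ 0]].
  apply/setP => x; apply/nzsquaresP/imsetP => -[y]; rewrite ?inE => *; exists y;
    by rewrite ?inE.
rewrite -leq_double; apply: (@leq_trans #|[set~ (0 : F)]|).
  by rewrite cardsC1 cardF.
rewrite -sum1_card (partition_big_imset (fun y : F => y ^+ 2)) /=.
rewrite -muln2 -sum_nat_const; apply: leq_sum => _ /imsetP[y _ ->].
rewrite sum1_card; apply: leq_trans (_ : #|[set y; - y]| <= 2)%N; last first.
  by rewrite cards2; case: eqP.
by apply/subset_leq_card/subsetP => z; rewrite !inE -eqf_sqr => /andP[_].
Qed.

(** * The binomial coefficients of m as elements of F *)

(** Translation by 1 permutes [F]; comparing the sums of all elements before and after gives q = 0
    in [F]. Thus [m] acts as -1/2. *)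
Lemma half_card_natr : 2 * m%:R + 1 = 0 :> F.
Proof.
have : \sum_(y : F) y = \sum_y (y + 1).
  exact: (reindex_inj (addIr (1 : F))).
rewrite big_split /= sumr_const cardF mulrSr -mul2n natrM => /eqP.
by rewrite eq_sym addrC -subr_eq0 addrK => /eqP.
Qed.

Lemma card_pchar3 : (3%:R = 0 :> F) -> (9 < #|F|)%N -> (27 %| #|F|)%N.
Proof.
move=> F3; have pF : 3 \in [pchar F] by rewrite inE /= F3 eqxx.
have /= -> := card_pprimeChar pF.
by case: logn => [|[|[|k]]] //; rewrite !expnS !mulnA dvdn_mulr.
Qed.

(** This is the recursion for the coefficients of the binomial series with exponent -1/2, free of
    denominators. *)
Lemma bin_half_card_natr i :
  (i < m)%N -> 2 * i.+1%:R * 'C(m, i.+1)%:R = - (2 * i%:R + 1) * 'C(m, i)%:R :> F.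
Proof.
move=> im; have := congr1 (fun n => n%:R : F) (mul_bin_left m i).
rewrite /= !natrM natrB ?(ltnW im) // -mulrA => ->.
have -> : 2 * ((m%:R - i%:R) * 'C(m, i)%:R)
  = (2 * m%:R + 1 - (2 * i%:R + 1)) * 'C(m, i)%:R :> F by ring.
by rewrite half_card_natr sub0r.
Qed.

(* In characteristic p != 3, k = 1 works because 'C(m, 1) = -1/2 and
   'C(m, 2) = 3/8; if p = 3 then 'C(m, 2) vanishes, but q > 9 makes q a multiple
   of 27 and k = 3 works. *)
Lemma bin_consecutive_neq0 : (9 < #|F|)%N ->
  exists k, [/\ (0 < k)%N, (k.+1 < m)%N, 'C(m, k)%:R != 0 :> F & 'C(m, k.+1)%:R != 0 :> F].
Proof.
move=> q9; have m4 : (4 < m)%N by move: q9; rewrite cardF; lia.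
have [F3|F3] := eqVneq (3%:R : F) 0; last first.
  have C1 : 'C(m, 1)%:R != 0 :> F.
    apply/eqP; rewrite bin1 => m0; have := half_card_natr.
    by rewrite m0 mulr0 add0r => /eqP; rewrite oner_eq0.
  exists 1; split=> //; first lia.
  apply/eqP => C2; have /eqP := bin_half_card_natr (ltnW (ltnW (ltnW m4))).
  have -> : 2 * 1%:R + 1 = 3%:R :> F by ring.
  by rewrite C2 mulr0 eq_sym mulf_eq0 oppr_eq0 (negPf F3) (negPf C1).
have pF : 3 \in [pchar F] by rewrite inE /= F3 eqxx.
have := card_pchar3 F3 q9; rewrite cardF => /bin_3_4_not_dvdn3[C3 C4].
by exists 3; split; rewrite -?(dvdn_pcharf pF).
Qed.

(** * Coefficient relations from power identities on Q *)

Lemma root_nzsquares_Xn_sub_1 : all (root ('X^m - 1 : {poly F})) (enum Q).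
Proof.
apply/allP => x; rewrite mem_enum => xQ.
by rewrite rootE hornerD hornerN hornerXn hornerC nzsquares_exp // subrr.
Qed.

Definition pow_diff (a b c d : F) : {poly F} :=
  (a *: 'X + b%:P) ^+ m - (c *: 'X + d%:P) ^+ m.

Lemma size_pow_diff a b c d : (size (pow_diff a b c d) <= m.+1)%N.
Proof.
rewrite /pow_diff !exp_linear_poly; apply: (leq_trans (size_polyD _ _)).
by rewrite size_polyN geq_max !size_poly.
Qed.

Lemma coef_pow_diff a b c d i : (i <= m)%N ->
  (pow_diff a b c d)`_i =
  (a ^+ i * b ^+ (m - i) - c ^+ i * d ^+ (m - i)) * 'C(m, i)%:R.
Proof.
by move=> im; rewrite coefB !exp_linear_poly !coef_poly ltnS im mulr_natr mulrnBl.
Qed.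

Lemma horner_pow_diff a b c d x :
  (pow_diff a b c d).[x] = (a * x + b) ^+ m - (c * x + d) ^+ m.
Proof. by rewrite /pow_diff !hornerE. Qed.

Lemma pow_diff_coef_eq0 a b c d : (0 < m)%N ->
    {in Q, forall x, (a * x + b) ^+ m = (c * x + d) ^+ m} ->
  forall i, (0 < i < m)%N -> (pow_diff a b c d)`_i = 0.
Proof.
move=> m0 H i /andP[i0 im].
have szr : size ('X^m - 1 : {poly F}) = m.+1 by rewrite size_XnsubC.
rewrite (@poly_eq_scale_monic _ (pow_diff a b c d) ('X^m - 1) (enum Q)).
- by rewrite coefZ [X in _ * X]coefB coefXn coef1 (ltn_eqF im) (gtn_eqF i0) subrr mulr0.
- exact: monicXnsubC.
- by rewrite szr size_pow_diff -cardE ltnS card_nzsquares.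
- exact: enum_uniq.
- apply/allP => x; rewrite mem_enum => xQ.
  by rewrite rootE horner_pow_diff H // subrr.
- exact: root_nzsquares_Xn_sub_1.
Qed.

(** The extra factor [a x + b] keeps the identity valid where the image is 0. With 0 added to Q
    there are at least m + 1 roots for a product of degree at most m + 1, which is thus a multiple
    of [X^(m+1) - X]. The left side is its coefficient of degree [i + 1]. *)
Lemma linear_pow_diff_coef_eq0 a b c d : (0 < m)%N ->
    b ^+ m.+1 = b * d ^+ m ->
    {in Q, forall x, (a * x + b) ^+ m.+1 = (a * x + b) * (c * x + d) ^+ m} ->
  forall i, (0 < i < m)%N ->
  a * (pow_diff a b c d)`_i + b * (pow_diff a b c d)`_i.+1 = 0.
Proof.
move=> m0 H0 H i /andP[i0 im].
have rE : 'X^(m.+1) - 'X = 'X * ('X^m - 1) :> {poly F} by rewrite mulrBr mulr1 -exprS.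
have r1 : 'X * ('X^m - 1) \is @monic F by rewrite monicMl ?monicX // monicXnsubC.
have szr : size ('X * ('X^m - 1) : {poly F})%R = m.+2.
  by rewrite mulrC size_mulX ?size_XnsubC // -size_poly_eq0 size_XnsubC.
pose p := (a *: 'X + b%:P) * pow_diff a b c d.
rewrite -coef_linearM -/p.
have szp : (size p <= m.+2)%N.
  apply: (leq_trans (size_polyMleq _ _)).
  have : (size (a *: 'X + b%:P)%R <= 2)%N.
    apply: (leq_trans (size_polyD _ _)); rewrite geq_max.
    rewrite (leq_trans (size_scale_leq _ _)) ?size_polyX //.
    by rewrite (leq_trans (size_polyC_leq1 _)).
  by move=> sz; rewrite -subn1 leq_subLR; apply: leq_add sz (size_pow_diff a b c d).
rewrite (@poly_eq_scale_monic _ p ('X * ('X^m - 1)) (0 :: enum Q)).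
- rewrite coefZ -rE [X in _ * X]coefB coefXn coefX eqSS (ltn_eqF im) eqSS (gtn_eqF i0).
  by rewrite subrr mulr0.
- exact: r1.
- by rewrite szr szp /= -cardE !ltnS card_nzsquares.
- by rewrite /= enum_uniq mem_enum inE eqxx.
- apply/andP; split.
    rewrite rootE /p hornerM horner_pow_diff hornerD hornerZ hornerX hornerC !mulr0 !add0r.
    by rewrite mulrBr -exprS H0 subrr.
  apply/allP => x; rewrite mem_enum => xQ.
  rewrite rootE /p hornerM horner_pow_diff hornerD hornerZ hornerX hornerC.
  by rewrite mulrBr -exprS H // subrr.
- rewrite /= rootM rootX eqxx /=; apply/allP => x xs.
  by rewrite rootM (allP root_nzsquares_Xn_sub_1) // orbT.
Qed.

(** * Solving the coefficient relations *)

(** Eliminating one side at a time gives [c^k d^n (a d - b c) = 0] and [a^k b^n (a d - b c) = 0]. So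
    one of a, b and one of c, d vanish, and the determinant excludes [a = c = 0] and [b = d = 0]. *)
Lemma cross_pow_eq (a b c d : F) k n : a * d - b * c != 0 ->
    a ^+ k * b ^+ n.+1 = c ^+ k * d ^+ n.+1 ->
    a ^+ k.+1 * b ^+ n = c ^+ k.+1 * d ^+ n ->
  (b = 0 /\ c = 0) \/ (a = 0 /\ d = 0).
Proof.
move=> det e1 e2.
have cd0 : c ^+ k * d ^+ n * (a * d - b * c) = 0.
  have -> : c ^+ k * d ^+ n * (a * d - b * c)
    = a * (c ^+ k * d ^+ n.+1) - b * (c ^+ k.+1 * d ^+ n) by rewrite !exprS; ring.
  by rewrite -e1 -e2 !exprS; ring.
have ab0 : a ^+ k * b ^+ n * (a * d - b * c) = 0.
  have -> : a ^+ k * b ^+ n * (a * d - b * c)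
    = d * (a ^+ k.+1 * b ^+ n) - c * (a ^+ k * b ^+ n.+1) by rewrite !exprS; ring.
  by rewrite e1 e2 !exprS; ring.
move/eqP: cd0; move/eqP: ab0; rewrite !mulf_eq0 (negPf det) !orbF !expf_eq0.
case/orP=> /andP[_ /eqP x0]; case/orP=> /andP[_ /eqP y0]; move: det; rewrite x0 y0.
- by rewrite mulr0 mul0r subrr eqxx.
- by right.
- by left.
- by rewrite mulr0 mul0r subrr eqxx.
Qed.

Lemma det_pow_eq (a b c d : F) : (9 < #|F|)%N -> a * d - b * c != 0 ->
    {in Q, forall x, (a * x + b) ^+ m = (c * x + d) ^+ m} ->
  (b = 0 /\ c = 0) \/ (a = 0 /\ d = 0).
Proof.
move=> q9 det H; have [k [k0 km Ck Ck1]] := bin_consecutive_neq0 q9.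
have C i : (0 < i < m)%N -> 'C(m, i)%:R != 0 :> F ->
    a ^+ i * b ^+ (m - i) = c ^+ i * d ^+ (m - i).
  move=> /andP[i0 im] Ci; have m0 := leq_trans i0 (ltnW im).
  have := pow_diff_coef_eq0 m0 H; move/(_ i); rewrite i0 im => /(_ isT).
  rewrite coef_pow_diff ?(ltnW im) // => /eqP.
  by rewrite mulf_eq0 (negPf Ci) orbF subr_eq0 => /eqP.
(* With [n = m - k - 1], the relations of index [k] and [k + 1] have the exponents [n + 1] and
   [n]. *)
apply: (@cross_pow_eq a b c d k (m - k.+1)) => //; last exact: C.
by rewrite subnSK ?(ltnW km) //; apply: C; rewrite // k0 ltnW.
Qed.

(** If [b != 0], the identity at 0 gives [b^m = d^m]. The relations then involve only [u = a / b]
    and [v = c / d], and those of index 1, 2, 3 contradict each other. *)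
Lemma linear_pow_eq (a b c d : F) : (9 < #|F|)%N -> a * d - b * c != 0 ->
    b ^+ m.+1 = b * d ^+ m ->
    {in Q, forall x, (a * x + b) ^+ m.+1 = (a * x + b) * (c * x + d) ^+ m} ->
  b = 0.
Proof.
move=> q9 det H0 H; apply/eqP; apply: contraT => b0.
have m4 : (4 < m)%N by move: q9; rewrite cardF; lia.
have m0 : (0 < m)%N by lia.
have bd : b ^+ m = d ^+ m by apply: (mulfI b0); rewrite -exprS.
have d0 : d != 0.
  by apply: contraNneq b0 => d0; move/eqP: bd; rewrite d0 expr0n gtn_eqF // expf_eq0 => /andP[].
have E := linear_pow_diff_coef_eq0 m0 H0 H.
have a0 : a != 0.
  (* For [a = 0], index [m - 1] isolates the leading coefficient [- c^m], so [c = 0] and the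
     determinant vanishes. *)
  apply: contraNneq det => a0; have m1 : (0 < m.-1 < m)%N by lia.
  have := E m.-1 m1; rewrite prednK // a0 mul0r add0r => /eqP.
  rewrite mulf_eq0 (negPf b0) coef_pow_diff // subnn binn !mulr1.
  rewrite expr0n gtn_eqF // sub0r oppr_eq0 expf_eq0 => /andP[_ /eqP->].
  by rewrite mul0r mulr0 subrr.
pose u := a / b; pose v := c / d.
have coefE i : (i <= m)%N ->
    (pow_diff a b c d)`_i = b ^+ m * ((u ^+ i - v ^+ i) * 'C(m, i)%:R).
  move=> im; rewrite coef_pow_diff // mulrA mulrBr {2}bd; congr ((_ - _) * _).
    by rewrite expr_div_n -{2}(subnK im) exprD mulrCA mulfK // expf_neq0.
  by rewrite expr_div_n -{2}(subnK im) exprD mulrCA mulfK // expf_neq0.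
have {}E i : (0 < i < m)%N ->
    u * ((u ^+ i - v ^+ i) * 'C(m, i)%:R)
    + (u ^+ i.+1 - v ^+ i.+1) * 'C(m, i.+1)%:R = 0.
  move=> im; have /andP[i0 im'] := im; have := E i im.
  rewrite !coefE ?(ltnW im') //.
  have -> : a = u * b by rewrite /u divfK.
  set f := _ * _%:R; set g := _ * _%:R.
  have -> : u * b * (b ^+ m * f) + b * (b ^+ m * g) = b ^+ m.+1 * (u * f + g).
    by rewrite exprS; ring.
  by move/eqP; rewrite mulf_eq0 expf_eq0 (negPf b0) andbF => /eqP.
have E1 : u * ((u - v) * 'C(m, 1)%:R) + (u ^+ 2 - v ^+ 2) * 'C(m, 2)%:R = 0.
  by apply: (E 1); lia.
have E2 := E 2; have E3 := E 3; rewrite (ltnW m4) in E3; rewrite (ltnW (ltnW m4)) in E2.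
have {E2} E2 := E2 isT; have {E3} E3 := E3 isT.
have uv : u - v != 0.
  rewrite subr_eq0; apply: contra det => /eqP uv; rewrite subr_eq0; apply/eqP.
  by rewrite -(divfK b0 a) -/u uv /v -mulrA [b * d]mulrC mulrA divfK // mulrC.
have u0 : u != 0 by rewrite mulf_neq0 ?invr_neq0.
(* As m = -1/2 in F, the binomials are -1/2, 3/8, -15/48, 105/384. The three
   relations then read u = 3 v, 21 = 0 and 480 = 0. *)
have C1 : 2 * 'C(m, 1)%:R + 1 = 0 :> F by rewrite bin1 half_card_natr.
have C2 : 8 * 'C(m, 2)%:R - 3 = 0 :> F.
  have -> : 8 * 'C(m, 2)%:R - 3
    = 2 * (2 * 2%:R * 'C(m, 2)%:R) - 3 :> F by ring.
  rewrite bin_half_card_natr; last by lia.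
  by transitivity (- 3 * (2 * 'C(m, 1)%:R + 1) : F); [ring | rewrite C1 mulr0].
have C3 : 48 * 'C(m, 3)%:R + 15 = 0 :> F.
  have -> : 48 * 'C(m, 3)%:R + 15
    = 8 * (2 * 3%:R * 'C(m, 3)%:R) + 15 :> F by ring.
  rewrite bin_half_card_natr; last by lia.
  by transitivity (- 5 * (8 * 'C(m, 2)%:R - 3) : F); [ring | rewrite C2 mulr0].
have C4 : 384 * 'C(m, 4)%:R - 105 = 0 :> F.
  have -> : 384 * 'C(m, 4)%:R - 105
    = 48 * (2 * 4%:R * 'C(m, 4)%:R) - 105 :> F by ring.
  rewrite bin_half_card_natr; last by lia.
  by transitivity (- 7 * (48 * 'C(m, 3)%:R + 15) : F); [ring | rewrite C3 mulr0].
have u3v : u = 3 * v.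
  apply/eqP; rewrite eq_sym -subr_eq0; apply/eqP.
  apply: (mulfI uv); rewrite mulr0.
  (* The multipliers are chosen to cancel the binomials; [(u - v) (3 v - u)] remains. *)
  transitivity (8 * (u * ((u - v) * 'C(m, 1)%:R) + (u ^+ 2 - v ^+ 2) * 'C(m, 2)%:R)
    - 4 * u * (u - v) * (2 * 'C(m, 1)%:R + 1)
    - (u ^+ 2 - v ^+ 2) * (8 * 'C(m, 2)%:R - 3)); first by ring.
  by rewrite E1 C1 C2 !mulr0 !subr0.
(* Since [u != 0], the equation [u = 3 v] also rules out characteristic 3. *)
have /andP[n3 v0] : (3 != 0 :> F) && (v != 0) by rewrite -negb_or -mulf_eq0 -u3v.
move: E2 E3; rewrite u3v => E2 E3.
have n21 : 21 = 0 :> F.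
  apply: (mulfI (expf_neq0 3 v0)); rewrite mulr0.
  (* The same elimination at [u = 3 v], where [u^2 - v^2], [u^3 - v^3], [u^4 - v^4] are [8 v^2],
     [26 v^3], [80 v^4]. *)
  transitivity (24 * (3 * v * (((3 * v) ^+ 2 - v ^+ 2) * 'C(m, 2)%:R)
      + ((3 * v) ^+ 3 - v ^+ 3) * 'C(m, 3)%:R)
    - 72 * v ^+ 3 * (8 * 'C(m, 2)%:R - 3)
    - 13 * v ^+ 3 * (48 * 'C(m, 3)%:R + 15)); first by ring.
  by rewrite E2 C2 C3 !mulr0 !subr0.
have n480 : 480 = 0 :> F.
  apply: (mulfI (expf_neq0 4 v0)); rewrite mulr0.
  transitivity (312 * v ^+ 4 * (48 * 'C(m, 3)%:R + 15)
    + 40 * v ^+ 4 * (384 * 'C(m, 4)%:R - 105)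
    - 192 * (3 * v * (((3 * v) ^+ 3 - v ^+ 3) * 'C(m, 3)%:R)
      + ((3 * v) ^+ 4 - v ^+ 4) * 'C(m, 4)%:R)); first by ring.
  by rewrite E3 C3 C4 !mulr0 subr0 addr0.
(* The gcd of 21 and 480 is 3, which is nonzero here. *)
have : 3 = 23 * 21 - 480 :> F by ring.
by rewrite n21 n480 mulr0 subr0 => /eqP; rewrite (negPf n3).
Qed.

End Squares.

(** * Möbius maps and setwise stabilisers *)

Section MobiusStabilisers.
Local Open Scope ring_scope.
Variable F : finFieldType.
Local Notation Q := (nzsquares F).

Lemma mem_projQ (z : option F) : (z \in projQ F) = if z is Some x then x \in Q else false.
Proof.
case: z => [x|]; first by rewrite mem_imset // => ? ? [].
by apply/imsetP => -[].
Qed.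

Lemma mem_projV0 (z : option F) :
  (z \in projV0 F) = if z is Some x then (x \in Q) || (x == 0) else false.
Proof. by rewrite !inE mem_projQ; case: z. Qed.

Lemma mem_projU0 (z : option F) :
  (z \in projU0 F) = if z is Some x then x \in Q else true.
Proof. by rewrite !inE mem_projQ; case: z => //= x; rewrite orbF. Qed.

Lemma mobius_SomeP (a b c d x y : F) :
  mobius a b c d (Some x) = Some y -> c * x + d != 0 /\ a * x + b = y * (c * x + d).
Proof. by rewrite /=; case: eqP => // /eqP h [<-]; rewrite divfK. Qed.

Lemma mobius_diag (a d : F) : d != 0 -> mobius a 0 0 d =1 mobius (a / d) 0 0 1.
Proof.
move=> d0 [x|] /=; last by rewrite eqxx.
by rewrite !mul0r !add0r !addr0 oner_eq0 (negPf d0) divr1 mulrAC.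
Qed.

Lemma mobius_antidiag (b c : F) : c != 0 -> mobius 0 b c 0 =1 mobius 0 (b / c) 1 0.
Proof.
move=> c0 [x|] /=; last by rewrite oner_eq0 (negPf c0) !mul0r.
rewrite !mul0r !add0r !addr0 mulf_eq0 (negPf c0) mul1r /=.
by case: eqP => // _; rewrite invfM mulrA.
Qed.

Lemma mobius_scaling_Some (a x : F) : mobius a 0 0 1 (Some x) = Some (a * x).
Proof. by rewrite /= mul0r add0r oner_eq0 addr0 divr1. Qed.

Lemma mobius_scaling_None (a : F) : mobius a 0 0 1 None = None.
Proof. by rewrite /= eqxx. Qed.

Lemma normPGL2P (S : {set option F}) (s : {perm (option F)}) :
  reflect (exists a b c d, [/\ a * d - b * c != 0, s =1 mobius a b c d
             & forall z, (mobius a b c d z \in S) = (z \in S)])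
          (s \in 'N_(PGL2 F)(S | 'P)%g).
Proof.
rewrite inE; apply: (iffP andP).
  move=> [/PGL2P[a [b [c [d [det sE]]]]] /astabsP nS].
  by exists a, b, c, d; split=> // z; rewrite -sE; apply: nS.
move=> [a [b [c [d [det sE nS]]]]]; split; first by apply/PGL2P; exists a, b, c, d.
by apply/astabsP => z; rewrite /= apermE sE.
Qed.

Lemma square_scalingsP (s : {perm (option F)}) :
  reflect (exists2 a, a \in Q & s =1 mobius a 0 0 1) (s \in square_scalings F).
Proof.
rewrite inE; apply: (iffP existsP) => [[a /andP[aQ /forallP sE]]|[a aQ sE]].
  by exists a => // z; apply/eqP.
by exists a; rewrite aQ; apply/forallP => z; apply/eqP.
Qed.

Lemma square_inversionsP (s : {perm (option F)}) :
  reflect (exists2 b, b \in Q & s =1 mobius 0 b 1 0) (s \in square_inversions F).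
Proof.
rewrite inE; apply: (iffP existsP) => [[b /andP[bQ /forallP sE]]|[b bQ sE]].
  by exists b => // z; apply/eqP.
by exists b; rewrite bQ; apply/forallP => z; apply/eqP.
Qed.

Lemma mobius_scaling_projQ (a : F) (z : option F) :
  a \in Q -> (mobius a 0 0 1 z \in projQ F) = (z \in projQ F).
Proof.
move=> aQ; case: z => [x|]; last by rewrite mobius_scaling_None.
by rewrite mobius_scaling_Some !mem_projQ nzsquaresMl.
Qed.

Lemma mobius_inversion_projQ (b : F) (z : option F) :
  b \in Q -> (mobius 0 b 1 0 z \in projQ F) = (z \in projQ F).
Proof.
move=> bQ; case: z => [x|]; rewrite !mem_projQ /=; last by rewrite oner_eq0 mul0r nzsquares0.
rewrite mul0r add0r mul1r addr0; have [->|x0] := eqVneq x 0; first by rewrite nzsquares0.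
by rewrite nzsquaresMl ?nzsquaresV.
Qed.

(** Common to V0 and U0: the first hypothesis gives the inclusion of the scalings in the stabiliser,
    the second the converse. *)
Lemma norm_square_scalings (S : {set option F}) :
    (forall (a : F) z, a \in Q -> (mobius a 0 0 1 z \in S) = (z \in S)) ->
    (forall a b c d : F, a * d - b * c != 0 ->
       (forall z, z \in S -> mobius a b c d z \in S) ->
     [/\ b = 0, c = 0, d != 0 & a / d \in Q]) ->
  ('N_(PGL2 F)(S | 'P))%g = square_scalings F.
Proof.
move=> QS SQ; apply/setP => s; apply/normPGL2P/square_scalingsP.
  move=> [a [b [c [d [det sE nS]]]]].
  have [|b0 c0 d0 adQ] := SQ a b c d det; first by move=> z; rewrite nS.
  by exists (a / d) => // z; rewrite sE b0 c0 mobius_diag.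
move=> [a aQ sE]; exists a, 0, 0, 1; split=> // [|z]; last exact: QS.
by rewrite mulr1 mulr0 subr0 nzsquares_neq0.
Qed.

Hypotheses (oddF : odd #|F|) (F9 : (9 < #|F|)%N).

Let m := #|F|./2.
Let cardF : #|F| = m.*2.+1.
Proof. by rewrite -[LHS]odd_double_half oddF. Qed.

(** * Maps sending Q, V0 or U0 into itself *)

Lemma mobius_projQ (a b c d : F) : a * d - b * c != 0 ->
    (forall z, z \in projQ F -> mobius a b c d z \in projQ F) ->
  [/\ b = 0, c = 0, d != 0 & a / d \in Q] \/ [/\ a = 0, d = 0, c != 0 & b / c \in Q].
Proof.
move=> det nQ.
have eqQ : {in Q, forall x, (a * x + b) ^+ m = (c * x + d) ^+ m}.
  move=> x xQ; have := nQ (Some x); rewrite !mem_projQ => /(_ xQ).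
  case e: mobius => [y|] // yQ; have [_ ->] := mobius_SomeP e.
  by rewrite exprMn (nzsquares_exp cardF yQ) mul1r.
(* The image of 1 is [a / d] or [b / c] in the two cases, so this ratio is a square. *)
have := nQ (Some 1); rewrite !mem_projQ => /(_ (nzsquares1 F)).
have [[b0 c0]|[a0 d0]] := det_pow_eq cardF F9 det eqQ.
  move: det; rewrite b0 c0 mul0r subr0 mulf_eq0 negb_or => /andP[_ dn0].
  rewrite /= mul0r add0r (negPf dn0) mulr1 addr0 => adQ.
  by left.
move: det; rewrite a0 d0 mul0r sub0r oppr_eq0 mulf_eq0 negb_or => /andP[_ cn0].
rewrite /= mul0r add0r addr0 mulr1 (negPf cn0) => bcQ.
by right.
Qed.

Lemma mobius_projV0 (a b c d : F) : a * d - b * c != 0 ->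
    (forall z, z \in projV0 F -> mobius a b c d z \in projV0 F) ->
  [/\ b = 0, c = 0, d != 0 & a / d \in Q].
Proof.
move=> det nV.
have eqV x : (x \in Q) || (x == 0) ->
    (a * x + b) ^+ m.+1 = (a * x + b) * (c * x + d) ^+ m.
  move=> xV; have := nV (Some x); rewrite !mem_projV0 => /(_ xV).
  case e: mobius => [y|] //; have [_ ->] := mobius_SomeP e.
  case/orP=> [yQ|/eqP->]; last by rewrite !mul0r expr0n.
  by rewrite exprS [X in _ * X]exprMn (nzsquares_exp cardF yQ) mul1r.
have b0 : b = 0.
  apply: (linear_pow_eq cardF F9 det) => [|x xQ]; last by rewrite eqV ?xQ.
  by have := eqV 0; rewrite eqxx orbT !mulr0 !add0r => ->.
have d0 : d != 0 by apply: contraNneq det => ->; rewrite b0 mulr0 mul0r subrr.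
have e0 : mobius a b c d (Some 0) = Some 0.
  by rewrite /= !mulr0 !add0r (negPf d0) b0 mul0r.
(* 0 is fixed and the map is injective, so no point of Q is sent to 0. *)
have nQ z : z \in projQ F -> mobius a b c d z \in projQ F.
  move=> zQ; have := nV z; rewrite inE zQ => /(_ isT).
  rewrite in_setU in_set1 => /orP[//|/eqP e].
  have z0 := mobius_inj det (etrans e (esym e0)).
  by move: zQ; rewrite z0 [Some 0 \in _]mem_projQ nzsquares0.
by case: (mobius_projQ det nQ) => // -[_ /eqP]; rewrite (negPf d0).
Qed.

(** Conjugation by [z |-> 1 / z] exchanges U0 with V0 and replaces [(a, b, c, d)] by [(d, c, b, a)].
    The case of V0 then makes [d / a] a square, hence also its inverse. *)
Lemma mobius_projU0 (a b c d : F) : a * d - b * c != 0 ->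
    (forall z, z \in projU0 F -> mobius a b c d z \in projU0 F) ->
  [/\ b = 0, c = 0, d != 0 & a / d \in Q].
Proof.
move=> det nU; pose inv := @mobius F 0 1 1 0.
have inv_det : 0 * 0 - 1 * 1 != 0 :> F by rewrite mul0r mulr1 sub0r oppr_eq0 oner_eq0.
have invV z : (inv z \in projU0 F) = (z \in projV0 F).
  rewrite mem_projU0 mem_projV0 /inv; case: z => [x|] /=; last first.
    by rewrite oner_eq0 mul0r nzsquares0.
  rewrite mul1r addr0 mul0r add0r; have [->|x0] := eqVneq x 0; first by rewrite orbT.
  by rewrite orbF div1r nzsquaresV.
have invU z : (inv z \in projV0 F) = (z \in projU0 F).
  rewrite -invV /inv mobius_comp // !mulr0 !mul0r !mulr1 !add0r addr0.
  by rewrite mobius_scalar ?oner_neq0.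
have det' : d * a - c * b != 0 by rewrite mulrC [c * b]mulrC.
have [|c0 b0 a0 adQ] := @mobius_projV0 d c b a det'.
  move=> z zV; have := nU (inv z); rewrite invV zV => /(_ isT).
  rewrite -invU /inv !mobius_comp //.
  by rewrite !mul0r !mul1r !mulr0 !mulr1 !add0r !addr0.
split=> //; first by apply: contraNneq det => ->; rewrite b0 mulr0 mul0r subrr.
by rewrite -nzsquaresV invf_div.
Qed.

End MobiusStabilisers.

Theorem theorem11 (q : nat) (F : finFieldType) (cardF : #|F| = q)
    (q_odd : odd q) (q_gt9 : 9 < q) :
  (q = 1 %[mod 4] ->
     ('N_(PGL2 F)(projQ F | 'P))%g = square_scalings F :|: square_inversions F)
  /\ (('N_(PGL2 F)(projV0 F | 'P))%g = square_scalings F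
      /\ ('N_(PGL2 F)(projU0 F | 'P))%g = square_scalings F).
Proof.
rewrite -cardF in q_odd q_gt9; split; [move=> _; apply/setP => s | split].
- rewrite in_setU; apply/normPGL2P/orP.
    move=> [a [b [c [d [det sE nQ]]]]].
    have [] := @mobius_projQ F q_odd q_gt9 a b c d det; first by move=> z; rewrite nQ.
      (* Matrices matter up to a scalar: dividing by [d], or by [c] in the antidiagonal case, gives
         the normal form. *)
      move=> [b0 c0 d0 adQ]; left; apply/square_scalingsP; exists (a / d)%R => // z.
      by rewrite sE b0 c0 mobius_diag.
    move=> [a0 d0 c0 bcQ]; right; apply/square_inversionsP; exists (b / c)%R => // z.
    by rewrite sE a0 d0 mobius_antidiag.
  case=> [/square_scalingsP[a aQ sE]|/square_inversionsP[b bQ sE]].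
    exists a, 0%R, 0%R, 1%R; split=> // [|z]; last exact: mobius_scaling_projQ.
    by rewrite mulr1 mulr0 subr0 nzsquares_neq0.
  exists 0%R, b, 1%R, 0%R; split=> // [|z]; last exact: mobius_inversion_projQ.
  by rewrite mulr0 mulr1 sub0r oppr_eq0 nzsquares_neq0.
- apply: norm_square_scalings => [a [x|] aQ|]; last exact: mobius_projV0.
    rewrite mobius_scaling_Some !mem_projV0 nzsquaresMl // mulf_eq0.
    by rewrite (negPf (nzsquares_neq0 aQ)).
  by rewrite mobius_scaling_None.
- apply: norm_square_scalings => [a [x|] aQ|]; last exact: mobius_projU0.
    by rewrite mobius_scaling_Some !mem_projU0 nzsquaresMl.
  by rewrite mobius_scaling_None.
Qed.
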